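(* Let $G$ be a graph with a near $\alpha$-valuation $p$, with associated partition $V(G)=V_{small}\cup V_{large}$, and let $l$ be a positive integer. Let $G_{l,1}$ be the blow-up of $G$ in which every vertex of $V_{small}$ is replaced by a set of $l$ vertices and every vertex of $V_{large}$ is replaced by a single vertex. Then $G_{l,1}$ admits a near $\alpha$-valuation.
   Context: A $\beta$-valuation of a graph with $n$ edges is an injective $b:V\to\{0,\ldots,n\}$ such that the multiset of edge values $|b(u)-b(v)|$ over all edges $\{u,v\}$ is $\{1,\ldots,n\}$. A near $\alpha$-valuation is a $\beta$-valuation with a partition $V=V_{small}\cup V_{large}$ such that every vertex of $V_{small}$ has label smaller than the labels of all its neighbours and every vertex of $V_{large}$ has label larger than the labels of all its neighbours. A blow-up of a graph $G$ replaces each vertex $s$ by a nonempty set $V_s$ of new vertices, with every vertex of $V_s$ adjacent to every vertex of $V_t$ exactly when $\{s,t\}\in E(G)$ (and no other edges). *)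

(* Defs.v *)
From HB Require Import structures.
From mathcomp Require Import all_boot all_order all_algebra.

Set Implicit Arguments.
Unset Strict Implicit.
Unset Printing Implicit Defensive.

Import IntDist.

Local Open Scope nat_scope.

Record sgraph := SGraph {
  vertex :> finType;
  adj : rel vertex;
  adj_sym : symmetric adj;
  adj_irr : irreflexive adj }.

Definition edges (G : sgraph) : {set {set G}} :=
  [set E : {set G} | [exists u, exists v, adj u v && (E == [set u; v])]].

(* On a two-element set [set u; v] this is `|b u - b v|: see edge_valueE. *)
Definition edge_value (G : sgraph) (b : G -> nat) (E : {set G}) : nat :=
  \max_(u in E) \max_(v in E) `|b u - b v|.

Lemma edge_valueE (G : sgraph) (b : G -> nat) (u v : G) :
  edge_value b [set u; v] = `|b u - b v|.
Proof.
apply/eqP; rewrite eqn_leq; apply/andP; split.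
  apply/bigmax_leqP => x /set2P Hx; apply/bigmax_leqP => y /set2P Hy.
  by case: Hx => ->; case: Hy => ->; rewrite ?distnn // distnC.
by apply: (bigmax_sup u); rewrite ?set21 //; apply: (bigmax_sup v); rewrite ?set22.
Qed.

(* Multisets are compared as sequences up to permutation. *)
Definition beta_valuation (G : sgraph) (b : G -> nat) : Prop :=
  [/\ injective b,
      forall v, b v <= #|edges G|
    & perm_eq [seq edge_value b E | E <- enum (edges G)] (iota 1 #|edges G|)].

(* The parts of a partition are nonempty, as for finset.partition.  This only
   excludes the edgeless graphs with at most one vertex: any edge has an end in
   each part, and without edges all labels are 0. *)
Definition bipartition (T : finType) (S L : {set T}) : Prop :=
  [/\ S != set0, L != set0, [disjoint S & L] & S :|: L = [set: T]].

Definition near_alpha_valuation_with (G : sgraph) (b : G -> nat)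
    (S L : {set G}) : Prop :=
  [/\ beta_valuation b,
      bipartition S L,
      forall u v : G, u \in S -> adj u v -> b u < b v
    & forall u v : G, u \in L -> adj u v -> b v < b u].

Definition near_alpha_valuation (G : sgraph) (b : G -> nat) : Prop :=
  exists S L : {set G}, near_alpha_valuation_with b S L.

Section BlowUp.
Variables (G : sgraph) (m : G -> nat).

Definition blowup_vertex : finType := {s : G & 'I_(m s)}.

Definition blowup_adj : rel blowup_vertex :=
  fun x y => adj (tag x) (tag y).

Lemma blowup_adj_sym : symmetric blowup_adj.
Proof. by move=> x y; apply: adj_sym. Qed.

Lemma blowup_adj_irr : irreflexive blowup_adj.
Proof. by move=> x; apply: adj_irr. Qed.

(* The vertex s is replaced by m s copies; a blow-up in the usual sense
   requires m to be positive everywhere. *)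
Definition blowup : sgraph := SGraph blowup_adj_sym blowup_adj_irr.
End BlowUp.

(* G_{l,1} for the partition into S and its complement. *)
Definition blowup_small (G : sgraph) (S : {set G}) (l : nat) : sgraph :=
  blowup (fun s : G => if s \in S then l else 1).

(* Main.v *)
Require Import Defs.
From mathcomp Require Import all_boot all_order all_algebra.
From mathcomp Require Import zify.

(** Copy [i < l] of a vertex [s] gets the label [l * p s + i].  An edge of value
    [d] of [G] then becomes [l] edges of values [l * d - i], [0 <= i < l], and
    these blocks tile [1, ..., l * n] as [d] runs over [1, ..., n].  The labels
    stay below [l * n] because the vertex labelled [n] is an end of the edge of
    value [n], hence is large and has a single copy. *)

Import IntDist.

Set Implicit Arguments.
Unset Strict Implicit.
Unset Printing Implicit Defensive.

Local Open Scope nat_scope.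

(** * Edges as pairs, copies, and Euclidean division *)

Lemma edgesP (G : sgraph) (E : {set G}) :
  reflect (exists u v, adj u v /\ E = [set u; v]) (E \in edges G).
Proof.
rewrite inE; apply: (iffP existsP) => [[u /existsP[v /andP[uv /eqP->]]]|].
  by exists u, v.
by move=> [u [v [uv ->]]]; exists u; apply/existsP; exists v; rewrite uv eqxx.
Qed.

(** The second components live in different ordinal types, so they are compared as naturals, which
    avoids any transport. *)
Lemma tagged_eqP (I : Type) (m : I -> nat) (x y : {s : I & 'I_(m s)}) :
  tag x = tag y -> tagged x = tagged y :> nat -> x = y.
Proof.
case: x y => [s i] [t j] /= st; move: st j => <- j ij.
by rewrite (val_inj ij).
Qed.

(** Uniqueness of quotient and remainder modulo [l]; it serves for the labels and again for the edge
    values. *)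
Lemma mulnD_lt_inj (l a b i j : nat) :
  i < l -> j < l -> l * a + i = l * b + j -> a = b /\ i = j.
Proof.
move=> il jl e; have l_gt0 : 0 < l by lia.
have ab : a = b.
  by have := congr1 (divn^~ l) e; rewrite /= ![l * _]mulnC !divnMDl // !divn_small // !addn0.
by split=> //; move: e; rewrite ab; apply: addnI.
Qed.

(** * Near alpha-valuations of the original graph *)

Section NearAlpha.
Variables (G : sgraph) (p : G -> nat) (S L : {set G}).
Hypothesis hp : near_alpha_valuation_with p S L.

Lemma near_alpha_inj : injective p.
Proof. by case: hp => -[]. Qed.

Lemma near_alpha_largeE (v : G) : (v \in L) = (v \notin S).
Proof.
case: hp => _ [_ _ dSL cSL] _ _.
have := in_setT v; rewrite -cSL inE.
by have [vS _|_ /= ->] := boolP (v \in S); rewrite // (disjointFr dSL vS).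
Qed.

(** Two adjacent vertices in the same part would each have the strictly smaller, or each the
    strictly larger, label. *)
Lemma near_alpha_adj_small (u v : G) :
  adj u v -> (u \in S) = (v \notin S).
Proof.
case: hp => _ _ hS hL uv; have vu : adj v u by rewrite adj_sym.
have [uS|uS] := boolP (u \in S); have [vS|vS] := boolP (v \in S) => //.
  by have := ltn_trans (hS _ _ uS uv) (hS _ _ vS vu); rewrite ltnn.
move: uS vS; rewrite -!near_alpha_largeE => uL vL.
by have := ltn_trans (hL _ _ uL uv) (hL _ _ vL vu); rewrite ltnn.
Qed.

Lemma near_alpha_edge_value_inj : {in edges G &, injective (edge_value p)}.
Proof.
case: hp => -[_ _ hperm] _ _ _.
by apply/dinjectiveP; rewrite /dinjectiveb (perm_uniq hperm) iota_uniq.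
Qed.

(** Distinct edges have distinct values, so the two edges agree as sets; their ends are matched
    because each edge has exactly one small end. *)
Lemma near_alpha_edge_inj (s t s' t' : G) :
  s \in S -> s' \in S -> adj s t -> adj s' t' ->
  p t - p s = p t' - p s' -> s = s' /\ t = t'.
Proof.
case: (hp) => _ _ hS _ sS s'S st s't' e.
have lt1 := hS _ _ sS st; have lt2 := hS _ _ s'S s't'.
have tS : t \notin S by rewrite -(near_alpha_adj_small st).
have t'S : t' \notin S by rewrite -(near_alpha_adj_small s't').
have E : [set s; t] = [set s'; t'].
  apply: near_alpha_edge_value_inj; [by apply/edgesP; exists s, t
    | by apply/edgesP; exists s', t' |].
  by rewrite !edge_valueE !distnEr // ltnW.
have := set21 s t; have := set22 s t; rewrite !E !inE.
move=> /orP[]/eqP Et /orP[]/eqP Es; subst; split=> //.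
all: by rewrite ?s'S ?sS in tS t'S.
Qed.

Lemma near_alpha_edge_of_value (d : nat) : 0 < d <= #|edges G| ->
  exists s t, [/\ s \in S, adj s t & p t - p s = d].
Proof.
move=> hd; case: (hp) => -[_ _ hperm] _ hS _.
have : d \in [seq edge_value p E | E <- enum (edges G)].
  by rewrite (perm_mem hperm) mem_iota add1n.
case/mapP=> E; rewrite mem_enum => /edgesP[u [v [uv ->]]].
rewrite edge_valueE.
have := near_alpha_adj_small uv; have [uS _|_ /esym/negbFE vS] := boolP (u \in S).
  by rewrite distnEr ?(ltnW (hS _ _ uS uv)) // => ->; exists u, v.
have vu : adj v u by rewrite adj_sym.
by rewrite distnEl ?(ltnW (hS _ _ vS vu)) // => ->; exists v, u.
Qed.

Lemma near_alpha_small_lt (s : G) : s \in S -> p s < #|edges G|.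
Proof.
move=> sS; case: (hp) => -[_ hle _] [_ /set0Pn[t tL] _ _] hS _.
rewrite ltn_neqAle hle andbT; apply/eqP => ps.
(* Without edges all labels are 0, and injectivity would identify the small [s] with the large
   [t]. *)
have [n0|n_gt0] := posnP #|edges G|.
  have st : s = t by apply: near_alpha_inj; have := hle s; have := hle t; lia.
  by move: tL; rewrite near_alpha_largeE -st sS.
have [|u [v [uS uv e]]] := @near_alpha_edge_of_value #|edges G|.
  by rewrite n_gt0 leqnn.
(* As labels are at most [#|edges G|], a difference that large forces its larger term [p v] to be
   [#|edges G|], the label of [s]. *)
have vs : v = s by apply: near_alpha_inj; have := hle v; lia.
by have := near_alpha_adj_small uv; rewrite uS vs sS.
Qed.

End NearAlpha.

(** * The labelling of the blow-up *)

Section BlowUpSmall.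
Variables (G : sgraph) (p : G -> nat) (S L : {set G}) (l : nat).
Hypothesis hp : near_alpha_valuation_with p S L.
Hypothesis hl : 0 < l.

Local Notation H := (blowup_small S l).

Definition copy_index (x : H) : nat := tagged x.

Definition blowup_label (x : H) : nat := l * p (tag x) + copy_index x.

Lemma copy_index_lt (x : H) : copy_index x < l.
Proof.
rewrite /copy_index; case: x => s i /=; apply: leq_trans (ltn_ord i) _.
by case: ifP.
Qed.

Lemma copy_index_large (x : H) : tag x \notin S -> copy_index x = 0.
Proof.
rewrite /copy_index; case: x => s i /= sS; apply/eqP; rewrite -leqn0 -ltnS.
by apply: leq_trans (ltn_ord i) _; rewrite (negbTE sS).
Qed.

Lemma blowup_label_inj : injective blowup_label.
Proof.
move=> x y /(mulnD_lt_inj (copy_index_lt x) (copy_index_lt y))[pxy ixy].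
exact: tagged_eqP (near_alpha_inj hp pxy) ixy.
Qed.

Lemma blowup_label_le (x : H) : blowup_label x <= l * #|edges G|.
Proof.
rewrite /blowup_label; case: (hp) => -[_ hle _] _ _ _.
have [xS|xS] := boolP (tag x \in S).
  by have := near_alpha_small_lt hp xS; have := copy_index_lt x; nia.
by rewrite (copy_index_large xS) addn0 leq_mul2l hle orbT.
Qed.

(** A gap of at least 1 between labels of [G] becomes a gap of at least [l], which exceeds the copy
    index of [x]. *)
Lemma blowup_label_lt (x y : H) : tag x \in S -> adj x y ->
  blowup_label x < blowup_label y.
Proof.
move=> xS xy; case: (hp) => _ _ hS _.
have := hS _ _ xS xy; have := copy_index_lt x; rewrite /blowup_label; nia.
Qed.

Lemma blowup_edge_value (x y : H) : tag x \in S -> adj x y ->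
  edge_value blowup_label [set x; y] = l * (p (tag y) - p (tag x)) - copy_index x.
Proof.
move=> xS xy; rewrite edge_valueE distnEr ?(ltnW (blowup_label_lt xS xy)) //.
have yS : tag y \notin S by rewrite -(near_alpha_adj_small hp xy).
by rewrite /blowup_label (copy_index_large yS) mulnBr; lia.
Qed.

Lemma blowup_edgesP (E : {set H}) : E \in edges H ->
  exists x y : H, [/\ tag x \in S, adj x y & E = [set x; y]].
Proof.
case/edgesP=> x [y [xy ->]]; have [xS|xS] := boolP (tag x \in S).
  by exists x, y.
exists y, x; split; last exact: setUC; last by rewrite adj_sym.
by have := near_alpha_adj_small hp xy; rewrite (negbTE xS) => /esym/negbFE.
Qed.

(** The value [l * d - i] determines [d] and [i]; then [d] determines the edge of [G], [i] the copy
    of its small end, and the large end has one copy. *)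
Lemma blowup_edge_value_inj :
  {in edges H &, injective (edge_value blowup_label)}.
Proof.
move=> E F /blowup_edgesP[x [y [xS xy ->]]] /blowup_edgesP[x' [y' [x'S xy' ->]]].
rewrite !blowup_edge_value // => e; case: (hp) => _ _ hS _.
have yS : tag y \notin S by rewrite -(near_alpha_adj_small hp xy).
have y'S : tag y' \notin S by rewrite -(near_alpha_adj_small hp xy').
have lt1 := hS _ _ xS xy; have lt2 := hS _ _ x'S xy'.
have il := copy_index_lt x; have il' := copy_index_lt x'.
have [ed ei] : p (tag y) - p (tag x) = p (tag y') - p (tag x')
    /\ copy_index x = copy_index x'.
  move: e il il' lt1 lt2; move: (p (tag y)) (p (tag x)) (p (tag y')) (p (tag x')).
  move=> a b c d e il il' lt1 lt2.
  (* With [d = a' + 1], the value [l * d - i] minus 1 is [l * a' + (l - 1 - i)], a Euclidean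
     division by [l]. *)
  have [a' ea] : exists a', a - b = a'.+1 by exists (a - b).-1; lia.
  have [c' ec] : exists c', c - d = c'.+1 by exists (c - d).-1; lia.
  rewrite ea ec in e *.
  have [] // := @mulnD_lt_inj l a' c' (l.-1 - copy_index x) (l.-1 - copy_index x').
  - lia.
  - lia.
  - move: e; rewrite !mulnS; lia.
  - by move=> -> ?; split=> //; lia.
have [tx ty] := near_alpha_edge_inj hp xS x'S xy xy' ed.
rewrite (tagged_eqP tx ei) (tagged_eqP ty) //.
by rewrite -!/(copy_index _) !copy_index_large.
Qed.

Lemma mem_blowup_edge_values :
  [seq edge_value blowup_label E | E <- enum (edges H)]
    =i iota 1 (l * #|edges G|).
Proof.
move=> k; rewrite mem_iota add1n ltnS; apply/mapP/idP.
  case=> E; rewrite mem_enum => /blowup_edgesP[x [y [xS xy ->]]] ->.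
  rewrite blowup_edge_value //; case: (hp) => -[_ hle _] _ hS _.
  have lt_xy := hS _ _ xS xy; have il := copy_index_lt x.
  have [d_gt0 d_le] : 0 < p (tag y) - p (tag x) /\ p (tag y) - p (tag x) <= #|edges G|.
    by have := hle (tag y); lia.
  have := leq_pmulr l d_gt0; have := leq_mul (leqnn l) d_le; lia.
move=> /andP[k_gt0 kle].
(* Dividing [k - 1] rather than [k] fits the block of [d], which runs from [l * (d - 1) + 1] to
   [l * d]; the remainder is [l - 1 - i]. *)
pose d := (k.-1 %/ l).+1; pose i := l.-1 - k.-1 %% l.
have kE := divn_eq k.-1 l; have kl := ltn_pmod k.-1 hl.
have [|s [t [sS st dE]]] := @near_alpha_edge_of_value _ _ _ _ hp d.
  by rewrite /d /= ltn_divLR // [_ * l]mulnC prednK.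
have tS : t \notin S by rewrite -(near_alpha_adj_small hp st).
have il : i < (if s \in S then l else 1) by rewrite sS /i; lia.
have jl : 0 < (if t \in S then l else 1) by rewrite (negbTE tS).
pose x : H := Tagged (fun s : G => 'I_(if s \in S then l else 1)) (Ordinal il).
pose y : H := Tagged (fun s : G => 'I_(if s \in S then l else 1)) (Ordinal jl).
exists [set x; y]; first by rewrite mem_enum; apply/edgesP; exists x, y.
by rewrite blowup_edge_value //= dE /copy_index /= /d /i mulnS [l * _]mulnC; lia.
Qed.

Lemma blowup_edge_values :
  perm_eq [seq edge_value blowup_label E | E <- enum (edges H)]
    (iota 1 (l * #|edges G|)).
Proof.
apply: uniq_perm; [|exact: iota_uniq|exact: mem_blowup_edge_values].
rewrite map_inj_in_uniq ?enum_uniq // => E F.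
by rewrite !mem_enum; apply: blowup_edge_value_inj.
Qed.

(** The edges are counted by the length of their list of values. *)
Lemma card_blowup_edges : #|edges H| = l * #|edges G|.
Proof. by have := perm_size blowup_edge_values; rewrite size_map size_iota -cardE. Qed.

Lemma blowup_label_near_alpha : near_alpha_valuation blowup_label.
Proof.
exists [set x | tag x \in S], [set x | tag x \notin S]; split.
- split; [exact: blowup_label_inj | |].
    by move=> x; rewrite card_blowup_edges blowup_label_le.
  by rewrite card_blowup_edges blowup_edge_values.
(* Since [l] is positive every vertex has a copy, so both parts stay nonempty. *)
- have copy s : exists x : H, tag x = s.
    have s0 : 0 < (if s \in S then l else 1) by case: ifP.
    by exists (Tagged (fun s : G => 'I_(if s \in S then l else 1)) (Ordinal s0)).
  case: (hp) => _ [/set0Pn[s sS] /set0Pn[t tL] _ _] _ _.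
  split.
  + by have [x xs] := copy s; apply/set0Pn; exists x; rewrite inE xs.
  + have [x xt] := copy t; apply/set0Pn; exists x.
    by rewrite inE xt -(near_alpha_largeE hp).
  + by rewrite disjoint_subset; apply/subsetP => x; rewrite !inE negbK.
  + by apply/setP => x; rewrite !inE orbN.
- by move=> x y; rewrite inE; apply: blowup_label_lt.
(* A neighbour of a copy of a large vertex lies over a small one, so the previous inequality applies
   with the ends exchanged. *)
- move=> x y; rewrite inE => xS xy; apply: blowup_label_lt; last by rewrite adj_sym.
  by have := near_alpha_adj_small hp xy; rewrite (negbTE xS) => /esym/negbFE.
Qed.

End BlowUpSmall.

Theorem theorem4p3 (G : sgraph) (p : G -> nat) (Vsmall Vlarge : {set G})
  (hp : near_alpha_valuation_with p Vsmall Vlarge) (l : nat) (hl : 0 < l) :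
  exists q : blowup_small Vsmall l -> nat, near_alpha_valuation q.
Proof. by exists (@blowup_label G p Vsmall l); apply: (blowup_label_near_alpha hp hl). Qed.
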